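(* For positive integers $n,k$ with $1\le k\le n$, both $\overline{B}_{n,k}(t)=B_{n,k}(t)+B_{n,\overline{k}}(t)$ and $\widetilde{B}_{n,k}(t)=tB_{n,k}(t)+B_{n,\overline{k}}(t)$ are gamma-positive, with centers of symmetry $n/2$ and $(n+1)/2$ respectively.
   Context: $\mathfrak{B}_n$ is the group of signed permutations: permutations $\pi$ of $\{\pm1,\dots,\pm n\}$ with $\pi(-i)=-\pi(i)$; write $\pi_i=\pi(i)$, $\pi_0=0$, and $\overline{k}=-k$. For $\pi\in\mathfrak{B}_n$, $\mathrm{des}_B(\pi)=|\{i\in\{0,1,\dots,n-1\}:\pi_i>\pi_{i+1}\}|$. For $k\in\{\pm1,\dots,\pm n\}$ let $\mathfrak{B}_{n,k}=\{\pi\in\mathfrak{B}_n:\pi_1=k\}$ and $B_{n,k}(t)=\sum_{\pi\in\mathfrak{B}_{n,k}}t^{\mathrm{des}_B(\pi)}$. A polynomial $f(t)$ is gamma-positive with center of symmetry $m/2$ ($m$ a nonnegative integer) if $f(t)=\sum_{i=0}^{\lfloor m/2\rfloor}\gamma_i t^i(1+t)^{m-2i}$ with all $\gamma_i\ge0$ (in particular the coefficients of $f$ satisfy $f_i=f_{m-i}$). *)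

(* Defs.v *)
From HB Require Import structures.
From mathcomp Require Import all_boot all_order all_algebra all_fingroup.

Set Implicit Arguments.
Unset Strict Implicit.
Unset Printing Implicit Defensive.

Import Order.TTheory GRing.Theory Num.Theory.

Local Open Scope ring_scope.

(* The set {+-1, ..., +-n}: the pair (s, i) stands for (-1)^s * (i + 1), so   *)
(* that s = true marks the negative elements.                                 *)
Notation sletter n := (bool * 'I_n)%type.

Definition sneg n (x : sletter n) : sletter n := (~~ x.1, x.2).

Definition sletter_val n (x : sletter n) : int := (-1) ^+ x.1 * x.2.+1%:Z.

Lemma sletter_val_neg n (x : sletter n) :
  sletter_val (sneg x) = - sletter_val x.
Proof.
by case: x => [[] i]; rewrite /sletter_val /= ?expr0 ?expr1 ?mulN1r ?opprK mul1r.
Qed.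

Lemma sletter_val_inj n : injective (@sletter_val n).
Proof.
move=> [[] i] [[] j]; rewrite /sletter_val /= ?expr0 ?expr1 ?mulN1r ?mul1r //.
  by move/oppr_inj => [] /val_inj ->.
by move=> [] /val_inj ->.
Qed.

Lemma sletter_valP n (z : int) :
  reflect (exists x : sletter n, sletter_val x = z) (0 < `|z| <= n)%N.
Proof.
apply: (iffP idP) => [/andP [z0 zn] | [[s i] <-]]; last first.
  by rewrite /sletter_val abszMsign absz_nat ltn_ord.
have lt_zn : (`|z|.-1 < n)%N by rewrite prednK.
exists (z < 0, Ordinal lt_zn); rewrite /sletter_val /= prednK //.
by rewrite -intEsign.
Qed.

Definition signed_perms n : {set {perm sletter n}} :=
  [set p : {perm sletter n} | [forall x, p (sneg x) == sneg (p x)]].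

Lemma signed_perms_group_set n : group_set (signed_perms n).
Proof.
apply/group_setP; split=> [|p q].
  by rewrite inE; apply/forallP => x; rewrite !perm1.
rewrite !inE => /forallP hp /forallP hq; apply/forallP => x.
by rewrite !permM (eqP (hp x)) (eqP (hq _)).
Qed.
Canonical signed_perms_group n := Group (signed_perms_group_set n).

(* The one-line notation p_0 p_1 ... p_n of p, with p_0 = 0; the value at     *)
(* i > n is a dummy 0.                                                        *)
Definition sperm_word n (p : {perm sletter n}) (i : nat) : int :=
  if i is j.+1 then
    if insub j is Some j' then sletter_val (p (false, j' : 'I_n)) else 0
  else 0.

Definition desB n (p : {perm sletter n}) : nat :=
  #|[set i : 'I_n | sperm_word p i > sperm_word p i.+1]|.

Definition signed_perms_first n (k : int) : {set {perm sletter n}} :=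
  [set p in signed_perms n | sperm_word p 1 == k].

Definition eulerB n (k : int) : {poly int} :=
  \sum_(p in signed_perms_first n k) 'X^(desB p).

(* m is twice the center of symmetry.                                         *)
Definition gamma_positive (R : numDomainType) (m : nat) (f : {poly R}) : Prop :=
  exists gamma : nat -> R,
    (forall i : nat, (i <= m./2)%N -> 0 <= gamma i) /\
    f = \sum_(i < m./2.+1) gamma i *: ('X^i * (1 + 'X) ^+ (m - i.*2)).

(* Main.v *)
Require Import Defs.
From mathcomp Require Import all_boot all_order all_algebra all_fingroup.
From mathcomp Require Import ring zify.

Set Implicit Arguments.
Unset Strict Implicit.
Unset Printing Implicit Defensive.

Import Order.TTheory GRing.Theory Num.Theory.
Local Open Scope ring_scope.

(** Deleting the first letter k of a signed permutation of size n + 1 and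
    standardising the remaining ones gives recurrences which, for the two
    symmetrised polynomials, read (j ranging over 1, ..., n)
      Bbar_{n+1,k} = sum_{j < k} 2 Btilde_{n,j} + sum_{j >= k} (1 + t) Bbar_{n,j},
      Btilde_{n+1,k} = sum_{j < k} (1 + t) Btilde_{n,j} + sum_{j >= k} 2t Bbar_{n,j}.
    Multiplication by 1 + t, respectively t, preserves gamma-positivity and moves
    the center of symmetry by 1/2, respectively 1, so induction on n concludes. *)

(** * Closure properties of gamma-positivity *)

Section GammaPositive.
Variable R : numDomainType.
Implicit Types (m : nat) (f g : {poly R}).

Lemma gamma_positive0 m : gamma_positive m (0 : {poly R}).
Proof. by exists (fun=> 0); split=> //; rewrite big1 // => i _; rewrite scale0r. Qed.

Lemma gamma_positiveD m f g :
  gamma_positive m f -> gamma_positive m g -> gamma_positive m (f + g).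
Proof.
move=> [c [c_ge0 ->]] [d [d_ge0 ->]]; exists (fun i => c i + d i); split.
  by move=> i im; rewrite addr_ge0 ?c_ge0 ?d_ge0.
by rewrite -big_split; apply: eq_bigr => i _; rewrite scalerDl.
Qed.

Lemma gamma_positiveZ m a f :
  0 <= a -> gamma_positive m f -> gamma_positive m (a *: f).
Proof.
move=> a_ge0 [c [c_ge0 ->]]; exists (fun i => a * c i); split.
  by move=> i im; rewrite mulr_ge0 ?c_ge0.
by rewrite scaler_sumr; apply: eq_bigr => i _; rewrite scalerA.
Qed.

Lemma gamma_positive_sum (I : finType) m (F : I -> {poly R}) :
  (forall i, gamma_positive m (F i)) -> gamma_positive m (\sum_i F i).
Proof.
move=> F_pos; apply: big_ind => //; first exact: gamma_positive0.
by move=> f g; apply: gamma_positiveD.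
Qed.

Lemma gamma_positive_basis m i :
  (i <= m./2)%N -> gamma_positive m ('X^i * (1 + 'X) ^+ (m - i.*2) : {poly R}).
Proof.
move=> im; exists (fun j => (j == i)%:R); split=> [j _|]; first exact: ler0n.
have im' : (i < m./2.+1)%N by [].
rewrite (bigD1 (Ordinal im')) //= eqxx scale1r big1 ?addr0 // => j.
by rewrite -val_eqE /= => /negbTE ->; rewrite scale0r.
Qed.

(** A basis element keeps its index [i], and its exponent [m - 2i] grows by one. *)
Lemma gamma_positiveM1X m f :
  gamma_positive m f -> gamma_positive m.+1 ((1 + 'X) * f).
Proof.
move=> [c [c_ge0 ->]]; rewrite mulr_sumr; apply: gamma_positive_sum => i.
have im : (i <= m./2)%N by rewrite -ltnS.
rewrite -scalerAr; apply: gamma_positiveZ; first exact: c_ge0.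
rewrite mulrCA -exprS.
rewrite (_ : (m - i.*2).+1 = m.+1 - i.*2)%N; last by lia.
by apply: gamma_positive_basis; lia.
Qed.

(** Here the index becomes [i + 1], and [m - 2i = (m + 2) - 2(i + 1)] leaves the other exponent
    fixed. *)
Lemma gamma_positiveMX m f :
  gamma_positive m f -> gamma_positive m.+2 ('X * f).
Proof.
move=> [c [c_ge0 ->]]; rewrite mulr_sumr; apply: gamma_positive_sum => i.
have im : (i <= m./2)%N by rewrite -ltnS.
rewrite -scalerAr; apply: gamma_positiveZ; first exact: c_ge0.
rewrite mulrA -exprS.
rewrite (_ : m - i.*2 = m.+2 - i.+1.*2)%N; last by lia.
by apply: gamma_positive_basis; lia.
Qed.

End GammaPositive.

(** * Standardisation and prepending a first letter *)

Lemma signed_permsP n (p : {perm sletter n}) :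
  reflect (forall x, p (sneg x) = sneg (p x)) (p \in signed_perms n).
Proof. by rewrite inE; apply: (iffP forallP) => h x; apply/eqP. Qed.

(** Inverse of standardisation: makes room for the two letters of index [k], keeping signs. *)
Definition lift_letter n (k : 'I_n.+1) (y : sletter n) : sletter n.+1 :=
  (y.1, lift k y.2).

Lemma lift_letter_inj n (k : 'I_n.+1) : injective (lift_letter k).
Proof.
by move=> [b i] [c j] /eqP; rewrite xpair_eqE (inj_eq lift_inj) /= => /andP[/eqP-> /eqP->].
Qed.

Lemma sletter_val_lift_lt n (k : 'I_n.+1) (y z : sletter n) :
  (sletter_val (lift_letter k y) < sletter_val (lift_letter k z))
  = (sletter_val y < sletter_val z).
Proof.
case: y z => [[] i] [[] j]; rewrite /sletter_val /= /bump ?expr0 ?expr1; lia.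
Qed.

(** Tells whether [x], followed by the letter that standardises to [y], makes a descent. The form by
    cases lets the recurrence simplify once the signs are known. *)
Definition desc_after n (x : sletter n.+1) (y : sletter n) : bool :=
  if y.1 then (x.1 ==> (x.2 <= y.2)%N) else ~~ x.1 && (y.2 < x.2)%N.

Lemma desc_afterE n (x : sletter n.+1) (y : sletter n) :
  desc_after x y = (sletter_val (lift_letter x.2 y) < sletter_val x).
Proof.
case: x y => [[] i] [[] j]; rewrite /desc_after /sletter_val /= /bump ?expr0 ?expr1; lia.
Qed.

Section Cons.
Variable n : nat.
Implicit Types (x : sletter n.+1) (q : {perm sletter n}).

Definition cons_fun x q (z : sletter n.+1) : sletter n.+1 :=
  if unlift ord0 z.2 is Some i then lift_letter x.2 (q (z.1, i))
  else (x.1 (+) z.1, x.2).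

Lemma cons_fun_inj x q : injective (cons_fun x q).
Proof.
move=> [b i] [c j]; rewrite /cons_fun /=.
case: unliftP => [i' ->|->]; case: unliftP => [j' ->|->].
- by move=> /lift_letter_inj /perm_inj [-> ->].
- by move=> /eqP; rewrite xpair_eqE [X in _ && X]eq_sym (negbTE (neq_lift _ _)) andbF.
- by move=> /eqP; rewrite xpair_eqE (negbTE (neq_lift _ _)) andbF.
- by move=> [/addbI ->].
Qed.

Definition cons_perm x q := perm (@cons_fun_inj x q).

Lemma cons_perm_lift x q b i :
  cons_perm x q (b, lift ord0 i) = lift_letter x.2 (q (b, i)).
Proof. by rewrite permE /cons_fun liftK. Qed.

Lemma cons_perm0 x q b : cons_perm x q (b, ord0) = (x.1 (+) b, x.2).
Proof. by rewrite permE /cons_fun unlift_none. Qed.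

Lemma cons_perm_inj x : injective (cons_perm x).
Proof.
move=> q r eq_qr; apply/permP => -[b i]; apply: (@lift_letter_inj _ x.2).
by rewrite -!cons_perm_lift eq_qr.
Qed.

Lemma cons_perm_signed x q :
  q \in signed_perms n -> cons_perm x q \in signed_perms n.+1.
Proof.
move=> /signed_permsP hq; apply/signed_permsP => -[b i].
case: (unliftP ord0 i) => [j ->|->]; rewrite /sneg /=.
  by rewrite !cons_perm_lift (hq (b, j)).
by rewrite !cons_perm0 /= addbN.
Qed.

Lemma cons_perm_surj x (p : {perm sletter n.+1}) :
  p \in signed_perms n.+1 -> p (false, ord0) = x ->
  exists2 q, q \in signed_perms n & p = cons_perm x q.
Proof.
move=> /signed_permsP hp p0.
have p0b b : p (b, ord0) = (x.1 (+) b, x.2).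
  case: b; last by rewrite p0 addbF -surjective_pairing.
  by rewrite (hp (false, ord0)) p0 addbT.
(* Both letters of index [x.2] are already images of the positions of index 0, so by injectivity
   every other value avoids that index and can be standardised. *)
have p_lift b i : {y | p (b, lift ord0 i) = lift_letter x.2 y}.
  case: (unliftP x.2 (p (b, lift ord0 i)).2) => [j e|e].
    by exists ((p (b, lift ord0 i)).1, j); rewrite /lift_letter -e -surjective_pairing.
  have /perm_inj/eqP :
      p (b, lift ord0 i) = p (x.1 (+) (p (b, lift ord0 i)).1, ord0).
    by rewrite p0b addKb -e -surjective_pairing.
  by rewrite xpair_eqE [X in _ && X]eq_sym (negbTE (neq_lift _ _)) andbF.
pose g (z : sletter n) := sval (p_lift z.1 z.2).
have gE b i : p (b, lift ord0 i) = lift_letter x.2 (g (b, i)).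
  by rewrite /g; case: (p_lift _ _).
have g_inj : injective g.
  move=> [b i] [c j] eg.
  have /perm_inj/(@lift_letter_inj _ _ (_, _) (_, _)) // :
      p (b, lift ord0 i) = p (c, lift ord0 j).
  by rewrite !gE eg.
exists (perm g_inj).
  apply/signed_permsP => -[b i]; rewrite !permE; apply: (@lift_letter_inj _ x.2).
  by rewrite -gE (hp (b, lift ord0 i)) gE.
apply/permP => -[b i]; case: (unliftP ord0 i) => [j ->|->].
  by rewrite cons_perm_lift permE gE.
by rewrite cons_perm0 p0b.
Qed.

End Cons.

(** * Descent polynomials by first letter and their recurrence *)

(* Unlike [desB], [desA] does not count a descent at position 0. *)
Definition desA n (p : {perm sletter n}) : nat :=
  \sum_(i < n.-1) (sperm_word p i.+2 < sperm_word p i.+1)%R.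

(** With position 0 ignored, deleting the first letter loses only the comparison of the first two
    letters; no new comparison with 0 appears. *)
Definition eulerA n (x : sletter n.+1) : {poly int} :=
  \sum_(p in signed_perms n.+1 | p (false, ord0) == x) 'X^(desA p).

Lemma sperm_wordS n (p : {perm sletter n}) (i : 'I_n) :
  sperm_word p i.+1 = sletter_val (p (false, i)).
Proof. by rewrite /sperm_word valK. Qed.

Lemma sperm_word1 n (p : {perm sletter n.+1}) :
  sperm_word p 1 = sletter_val (p (false, ord0)).
Proof. exact: (sperm_wordS p ord0). Qed.

(** Since [p_0 = 0], position 0 is a descent exactly when the first letter is negative. *)
Lemma desBE n (p : {perm sletter n.+1}) :
  desB p = ((p (false, ord0)).1 + desA p)%N.
Proof.
rewrite /desB -sum1_card big_mkcond big_ord_recl; congr (_ + _)%N.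
  by rewrite inE sperm_word1 /sletter_val; case: (p _) => [[] j].
by apply: eq_bigr => i _; rewrite inE; case: ifP.
Qed.

Lemma eulerBE n (x : sletter n.+1) :
  eulerB n.+1 (sletter_val x) = 'X^(x.1) * eulerA x.
Proof.
rewrite /eulerB /eulerA mulr_sumr; apply: eq_big => [p|p].
  by rewrite inE sperm_word1 (inj_eq (@sletter_val_inj _)).
rewrite inE sperm_word1 (inj_eq (@sletter_val_inj _)) => /andP[_ /eqP px].
by rewrite desBE px exprD.
Qed.

(** Lifting preserves the order of letters, so the descents of [q] survive and only the one right
    after [x] can be added. *)
Lemma desA_cons n (x : sletter n.+2) (q : {perm sletter n.+1}) :
  desA (cons_perm x q) = (desc_after x (q (false, ord0)) + desA q)%N.
Proof.
rewrite /desA big_ord_recl; congr (_ + _)%N.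
  rewrite (sperm_wordS _ (lift ord0 ord0)) sperm_word1.
  by rewrite cons_perm_lift cons_perm0 addbF desc_afterE -surjective_pairing.
apply: eq_bigr => i _.
rewrite (sperm_wordS _ (lift ord0 (lift ord0 i))).
rewrite (sperm_wordS _ (lift ord0 (widen_ord (leqnSn _) i))).
rewrite !cons_perm_lift sletter_val_lift_lt.
by rewrite (sperm_wordS q (lift ord0 i)) (sperm_wordS q (widen_ord (leqnSn _) i)).
Qed.

(** Prepending [x] is a bijection from the signed permutations of size [n] onto those of size
    [n + 1] that start with [x]. *)
Lemma eulerA_cons n (x : sletter n.+1) :
  eulerA x = \sum_(q in signed_perms n) 'X^(desA (cons_perm x q)).
Proof.
rewrite /eulerA -[RHS](big_imset (fun p => 'X^(desA p))) /=; last first.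
  by move=> q r _ _; apply: cons_perm_inj.
apply: eq_bigl => p; apply/andP/imsetP => [[hp /eqP px]|[q hq ->]].
  exact: cons_perm_surj.
by rewrite cons_perm_signed // cons_perm0 addbF -surjective_pairing.
Qed.

Lemma eulerA0 (x : sletter 1) : eulerA x = 1.
Proof.
rewrite eulerA_cons (_ : signed_perms 0 = [set 1%g]).
  by rewrite big_set1 /desA big_ord0.
apply/setP => p; rewrite in_set1; have -> : p = 1%g by apply/permP => -[? []].
by rewrite eqxx group1.
Qed.

(** Sort the shorter permutations by their own first letter; opposite letters are paired so that
    each summand can be matched with a symmetrised polynomial. *)
Lemma eulerAS n (x : sletter n.+2) :
  eulerA x = \sum_(i < n.+1)
    ('X^(desc_after x (true, i)) * eulerA (true, i)
     + 'X^(desc_after x (false, i)) * eulerA (false, i)).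
Proof.
rewrite eulerA_cons (partition_big (fun q : {perm _} => q (false, ord0)) xpredT) //=.
transitivity (\sum_(y : sletter n.+1) 'X^(desc_after x y) * eulerA y).
  apply: eq_bigr => y _; rewrite mulr_sumr; apply: eq_bigr => q /andP[_ /eqP qy].
  by rewrite desA_cons qy exprD.
rewrite big_split /=.
by rewrite -(pair_bigA _ (fun b i => 'X^(desc_after x (b, i)) * eulerA (b, i))) big_bool.
Qed.

(** By [eulerBE] these are the two symmetrised polynomials in size [n + 1]. They are treated
    together because each recurrence involves both. *)
Lemma eulerA_gamma_positive n (k : 'I_n.+1) :
  gamma_positive n.+1 (eulerA (false, k) + 'X * eulerA (true, k)) /\
  gamma_positive n.+2 ('X * (eulerA (false, k) + eulerA (true, k))).
Proof.
elim: n k => [|n IHn] k.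
  (* In size 1 the polynomials are [1 + t] and [2t]. *)
  rewrite !eulerA0 mulr1; split.
    rewrite (_ : 1 + 'X = 'X^0 * (1 + 'X) ^+ (1 - 0.*2)); last by rewrite expr0 mul1r.
    exact: gamma_positive_basis.
  rewrite (_ : _ * _ = 2 *: ('X^1 * (1 + 'X) ^+ (2 - 1.*2))).
    by apply: gamma_positiveZ => //; apply: gamma_positive_basis.
  by rewrite expr1 expr0 mulr1 mulrDr mulr1 scaler_nat mulr2n.
rewrite !eulerAS; split.
  rewrite mulr_sumr -big_split; apply: gamma_positive_sum => j /=.
  have [bar_pos til_pos] := IHn j.
  (* If [j < k], both letters of index [j] make a descent after the positive first letter and
     neither does after the negative one. If [j >= k], only the negative letter of index [j] makes a
     descent, whatever the sign of the first letter. *)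
  rewrite /desc_after /=; case: ltnP => jk.
    set f := (X in gamma_positive _ X).
    have -> : f = 2 *: ('X * (eulerA (false, j) + eulerA (true, j))).
      by rewrite scaler_nat /f; ring.
    exact: gamma_positiveZ.
  set f := (X in gamma_positive _ X).
  have -> : f = (1 + 'X) * (eulerA (false, j) + 'X * eulerA (true, j)).
    by rewrite /f; ring.
  exact: gamma_positiveM1X.
rewrite -big_split mulr_sumr; apply: gamma_positive_sum => j /=.
have [bar_pos til_pos] := IHn j.
rewrite /desc_after /=; case: ltnP => jk.
  set f := (X in gamma_positive _ X).
  have -> : f = (1 + 'X) * ('X * (eulerA (false, j) + eulerA (true, j))).
    by rewrite /f; ring.
  exact: gamma_positiveM1X.
set f := (X in gamma_positive _ X).
have -> : f = 2 *: ('X * (eulerA (false, j) + 'X * eulerA (true, j))).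
  by rewrite scaler_nat /f; ring.
by apply: gamma_positiveZ => //; apply: gamma_positiveMX.
Qed.

Theorem theorem8 (n k : nat) (hk : (1 <= k <= n)%N) :
  gamma_positive n (eulerB n k%:Z + eulerB n (- k%:Z)) /\
  gamma_positive n.+1 ('X * eulerB n k%:Z + eulerB n (- k%:Z)).
Proof.
case: n k hk => [|n] [|k] // kn; pose i : 'I_n.+1 := Ordinal kn.
(* A letter of index [i] has absolute value [i + 1], hence the shift of [k]. *)
have -> : k.+1%:Z = sletter_val (false, i) by rewrite /sletter_val expr0 mul1r.
rewrite -sletter_val_neg !eulerBE /= expr0 mul1r expr1 -mulrDr.
exact: eulerA_gamma_positive.
Qed.
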